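(* Let $k$ be a field of characteristic zero, $R=k[x_1,\ldots,x_n]$, and let $\mathbf{f}=\{f_1,\ldots,f_m\}\subset R$ be a set of distinct monomials of degree $2$. Assume that $\mathbf{f}$ is cohesive. Then the ideal $I=(\mathbf{f})\subset R$ is linearly presented if and only if the edge graph $\mathcal{L}(\mathbf{f})$ has diameter $\leq 2$.
   Context: $I=(\mathbf{f})$ is linearly presented if the module of first syzygies $\{(r_1,\ldots,r_m)\in R^m:\sum_j r_jf_j=0\}$ is generated by syzygies all of whose coordinates are linear forms (or zero). The set $\mathbf{f}$ is cohesive if there is no partition of the variables $x_1,\ldots,x_n$ into two nonempty sets $\mathbf{y},\mathbf{z}$ such that every monomial of $\mathbf{f}$ involves only $\mathbf{y}$-variables or only $\mathbf{z}$-variables. The edge graph $\mathcal{L}(\mathbf{f})$ is the simple graph whose vertices are the elements $f_1,\ldots,f_m$, two distinct vertices $f_i,f_j$ being adjacent if and only if $\gcd(f_i,f_j)\neq 1$. (When $\mathbf{f}$ is cohesive, $\mathcal{L}(\mathbf{f})$ is connected.) The distance between two vertices of a simple connected graph is the minimum length of a path connecting them, and the diameter is the largest distance between two of its vertices. *)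

(* Defs.v *)
From HB Require Import structures.
From mathcomp Require Import all_boot all_order all_algebra.
From mathcomp.multinomials Require Export mpoly.

Set Implicit Arguments.
Unset Strict Implicit.
Unset Printing Implicit Defensive.

Import GRing.Theory.
Local Open Scope ring_scope.

(* A monomial x^a of k[x_1, ..., x_n] is given by its exponent vector
   a : 'X_{1..n}; the monomial 1 is 0%MM, and 'X_[a] is x^a as a polynomial. *)

Section Syzygies.
Variables (k : fieldType) (n m : nat).
Implicit Types F r : 'I_m -> {mpoly k[n]}.

Definition syzygy F r : Prop := \sum_(j < m) r j * F j = 0.

(* The zero polynomial is homogeneous of every degree, so a coordinate of a
   linear syzygy may vanish. *)
Definition linear_syzygy F r : Prop :=
  syzygy F r /\ forall j, r j \is 1.-homog.

Definition linearly_presented F : Prop :=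
  forall r, syzygy F r ->
    exists (N : nat) (c : 'I_N -> {mpoly k[n]})
           (s : 'I_N -> 'I_m -> {mpoly k[n]}),
      (forall i, linear_syzygy F (s i)) /\
      (forall j, r j = \sum_(i < N) c i * s i j).

End Syzygies.

Section Cohesive.
Variables (n m : nat).

Definition involves_only (Y : {set 'I_n}) (a : 'X_{1..n}) : Prop :=
  forall i, (0 < a i)%N -> i \in Y.

Definition cohesive (f : 'I_m -> 'X_{1..n}) : Prop :=
  ~ exists Y : {set 'I_n},
      [/\ Y != set0, ~: Y != set0 &
          forall j, involves_only Y (f j) \/ involves_only (~: Y) (f j)].

End Cohesive.

Definition mgcd (n : nat) (a b : 'X_{1..n}) : 'X_{1..n} :=
  [multinom minn (a i) (b i) | i < n].

Lemma lem_mgcd (n : nat) (c a b : 'X_{1..n}) :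
  (c <= mgcd a b)%MM = (c <= a)%MM && (c <= b)%MM.
Proof.
apply/mnm_lepP/andP => [h | [/mnm_lepP ha /mnm_lepP hb] i].
  by split; apply/mnm_lepP => i; have := h i; rewrite mnmE leq_min => /andP[].
by rewrite mnmE leq_min ha hb.
Qed.

Definition edge_graph (n m : nat) (f : 'I_m -> 'X_{1..n}) : rel 'I_m :=
  fun i j => (i != j) && (mgcd (f i) (f j) != 0%MM).

Section Distance.
Variables (T : finType) (e : rel T).

Definition has_path_of_length (x y : T) (d : nat) : bool :=
  [exists p : d.-tuple T, [&& path e x p, last x p == y & uniq (x :: p)]].

(* A path without repeated vertices has length < #|T|, so this is the minimum
   length of a path from x to y whenever there is one; it is #|T| otherwise,
   which does not occur in a connected graph. *)
Definition distance (x y : T) : nat :=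
  find (has_path_of_length x y) (iota 0 #|T|).

Definition diameter : nat := \max_(x : T) \max_(y : T) distance x y.

End Distance.

(* Main.v *)
Require Import Defs.
From HB Require Import structures.
From mathcomp Require Import all_boot all_order all_algebra.
From mathcomp Require Import zify.

Set Implicit Arguments.
Unset Strict Implicit.
Unset Printing Implicit Defensive.

Import GRing.Theory.
Local Open Scope ring_scope.

(** Both conditions are compared with a third one, within_two: any two distinct
    monomials either share a variable or have a common neighbour in the edge
    graph.

    Within_two gives a linear presentation. Fix a multidegree a. If f_i and f_j
    divide a, then the multiples x^(a - f_i) e_i and x^(a - f_j) e_j of basis
    vectors have the same image x^a. When f_i and f_j are adjacent, their
    difference is a multiple of a linear syzygy, because the least common
    multiple has degree 3. When they are coprime, a common neighbour f_l takes
    one variable from each, so it divides f_i f_j and hence a, and the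
    difference passes through x^(a - f_l) e_l. Thus modulo the linear syzygies
    every element of the free module with image g is congruent to a lift of g
    depending on g alone (lift_congruent); a syzygy has image 0, and the lift
    of 0 is 0.

    Conversely, let f_i and f_j be coprime and write the Koszul syzygy
    f_j e_i - f_i e_j in terms of linear syzygies. Some linear syzygy s then has
    in its i-th coordinate a variable x dividing f_j. The term x f_i must cancel
    against a term of another coordinate l, so f_l divides x f_i; having degree
    2 and being different from f_i, f_l contains x and a variable of f_i, and is
    a common neighbour (linear_syzygy_common_neighbour).

    Finally, within_two says that the diameter is at most 2 (diameter_le2P);
    cohesion matters here only for a graph on two vertices, where the value
    assigned to the distance of unconnected vertices is itself 2. *)

(** * Vertices at distance at most two *)

Definition within_two {T : finType} (e : rel T) (x y : T) : bool :=
  [|| x == y, e x y | [exists z, e x z && e z y]].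

Lemma distance_le_length (T : finType) (e : rel T) (x y : T) (d : nat) :
  has_path_of_length e x y d -> (distance e x y <= d)%N.
Proof.
move=> hd; rewrite /distance; case: (ltnP d #|T|) => dT; last first.
  by apply: leq_trans (find_size _ _) _; rewrite size_iota.
rewrite leqNgt; apply/negP => /(before_find 0%N).
by rewrite nth_iota // add0n hd.
Qed.

Lemma within_two_distance (T : finType) (e : rel T) (x y : T) :
  within_two e x y -> (distance e x y <= 2)%N.
Proof.
rewrite /within_two; case: (eqVneq x y) => [<- _|xy /=].
  apply: leq_trans (@distance_le_length _ _ _ _ 0 _) _ => //.
  by apply/existsP; exists [tuple]; rewrite /= eqxx.
case exy: (e x y) => /=.
  move=> _; apply: leq_trans (@distance_le_length _ _ _ _ 1 _) _ => //.
  by apply/existsP; exists [tuple y]; rewrite /= exy eqxx inE xy.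
case/existsP => z /andP[exz ezy].
apply: distance_le_length; apply/existsP; exists [tuple z; y].
rewrite /= exz ezy eqxx !inE (negbTE xy) /= orbF.
have [xz|_] := eqVneq x z; first by rewrite xz ezy in exy.
by have [zy|//] := eqVneq z y; rewrite -zy exz in exy.
Qed.

(** When the type has at most two elements the default value of the distance
    between unconnected vertices is itself at most 2, whence the bound on the
    cardinal. *)
Lemma distance_within_two (T : finType) (e : rel T) (x y : T) :
  (2 < #|T|)%N -> (distance e x y <= 2)%N -> within_two e x y.
Proof.
move=> T3 d2; set s := iota 0 #|T|.
have hs : has (has_path_of_length e x y) s.
  by rewrite has_find size_iota; apply: leq_ltn_trans T3.
have := nth_find 0%N hs; rewrite -/(distance e x y) nth_iota ?add0n; last first.
  exact: leq_ltn_trans T3.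
rewrite /within_two; move: d2; case: (distance e x y) => [|[|[|//]]] _.
- by case/existsP => p; rewrite (tuple0 p) /= => /andP[->].
- case/existsP => p; case: p => [[|z [|//]] //= _].
  by rewrite andbT => /and3P[exz /eqP <- _]; rewrite exz orbT.
- case/existsP => p; case: p => [[|z [|t [|//]]] //= _].
  rewrite andbT => /and3P[/andP[exz ezt] /eqP <- _].
  by apply/or3P/Or33/existsP; exists z; rewrite exz ezt.
Qed.

(** Cohesion is what makes a graph on two vertices connected; on three or more
    vertices a bound on the diameter already excludes unconnected vertices. *)
Lemma diameter_le2P (n m : nat) (f : 'I_m -> 'X_{1..n}) :
  (forall j, mdeg (f j) = 2%N) -> cohesive f ->
  (diameter (edge_graph f) <= 2)%N <->
  (forall i j, within_two (edge_graph f) i j).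
Proof.
move=> fdeg fcoh; split=> [/bigmax_leqP diam i j | near]; last first.
  apply/bigmax_leqP => i _; apply/bigmax_leqP => j _.
  exact: within_two_distance.
case: (ltnP 2 #|'I_m|) => [m3|].
  by apply: distance_within_two => //; have /bigmax_leqP := diam i isT; apply.
rewrite card_ord => m2; case: (eqVneq i j) => [->|ij].
  by rewrite /within_two eqxx.
case: (eqVneq (mgcd (f i) (f j)) 0%MM) => [g0|g0]; last first.
  by rewrite /within_two /edge_graph ij g0 orbT.
have nz l : exists x, (0 < f l x)%N.
  have : f l != 0%MM by rewrite -mdeg_eq0 fdeg.
  case/boolP: [exists x, (0 < f l x)%N] => [/existsP //|].
  rewrite negb_exists => /forallP h; case/eqP; apply/mnmP => x.
  by rewrite mnm0E; have := h x; case: (f l x).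
have disj x : (0 < f i x)%N -> (0 < f j x)%N -> False.
  move=> hi hj; have := congr1 (fun a : 'X_{1..n} => a x) g0.
  by rewrite mnmE mnm0E /=; lia.
(* Here i and j are the only vertices, so the support of f_i and its complement
   contradict cohesion. *)
case: fcoh; exists [set x | (0 < f i x)%N]; split.
- by apply/set0Pn; case: (nz i) => x hx; exists x; rewrite inE.
- apply/set0Pn; case: (nz j) => x hx; exists x; rewrite !inE.
  by apply/negP => /disj; apply.
move=> l; have [->|->] : l = i \/ l = j.
  have ltl := ltn_ord l; have lti := ltn_ord i; have ltj := ltn_ord j.
  move: ij; rewrite -val_eqE /= => ij.
  case: (eqVneq (val l) i) => [/val_inj ->|li]; [by left | right].
  apply: val_inj => /=; move: ij li; rewrite /= => ij li; lia.
- by left => x hx; rewrite inE.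
- by right => x hx; rewrite !inE; apply/negP => /disj; apply.
Qed.

(** * Monomials of degree two *)

Lemma mdeg_lepm_eq (n : nat) (a b : 'X_{1..n}) :
  (a <= b)%MM -> (mdeg b <= mdeg a)%N -> a = b.
Proof.
move=> ab dba; have := congr1 (@mdeg n) (submK ab); rewrite mdegD => d.
have /eqP : mdeg (b - a)%MM = 0%N by lia.
by rewrite mdeg_eq0 => /eqP e; rewrite -(submK ab) e add0m.
Qed.

Lemma subm_mgcdK (n : nat) (a b : 'X_{1..n}) : (a - b + mgcd a b)%MM = a.
Proof. by apply/mnmP => x; rewrite mnmDE mnmBE mnmE; lia. Qed.

Lemma subm_addC (n : nat) (a b : 'X_{1..n}) : (a - b + b = b - a + a)%MM.
Proof. by apply/mnmP => x; rewrite !mnmDE !mnmBE; lia. Qed.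

Lemma mgcdC (n : nat) (a b : 'X_{1..n}) : mgcd a b = mgcd b a.
Proof. by apply/mnmP => x; rewrite !mnmE minnC. Qed.

Lemma mgcdl (n : nat) (a b : 'X_{1..n}) : (mgcd a b <= a)%MM.
Proof. by apply/mnm_lepP => x; rewrite mnmE geq_minl. Qed.

Lemma mdeg_subm_overlap (n : nat) (a b : 'X_{1..n}) :
  mdeg a = 2%N -> mdeg b = 2%N -> a <> b -> mgcd a b != 0%MM ->
  mdeg (a - b)%MM = 1%N.
Proof.
move=> da db ab; rewrite -mdeg_eq0 => g0.
have := congr1 (@mdeg n) (subm_mgcdK a b); rewrite mdegD da => e.
suff : mdeg (mgcd a b) <> 2%N by lia.
move=> g2; case: ab.
rewrite -(mdeg_lepm_eq (mgcdl a b)) ?g2 ?da // mgcdC.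
by apply: mdeg_lepm_eq (mgcdl b a) _; rewrite mgcdC g2 db.
Qed.

(** As a and b have disjoint supports, the product of gcd (c, a) and gcd (c, b)
    divides c; both factors being nontrivial, it is c. *)
Lemma overlap_both_lepm (n : nat) (a b c : 'X_{1..n}) :
  mdeg c = 2%N -> mgcd a b = 0%MM -> mgcd c a != 0%MM -> mgcd c b != 0%MM ->
  (c <= a + b)%MM.
Proof.
move=> dc ab; rewrite -!mdeg_eq0 => ca cb.
have e : (mgcd c a + mgcd c b)%MM = c.
  apply: mdeg_lepm_eq; last by rewrite mdegD dc; lia.
  apply/mnm_lepP => x; have := congr1 (fun u : 'X_{1..n} => u x) ab.
  by rewrite mnmDE !mnmE; lia.
by apply/mnm_lepP => x; rewrite -e mnmDE !mnmE; lia.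
Qed.

(** Without x, the monomial c would divide a and equal it; coprime to a, it
    would divide x. Both contradict the degrees. *)
Lemma lepm_addU_overlap (n : nat) (x : 'I_n) (a c : 'X_{1..n}) :
  mdeg a = 2%N -> mdeg c = 2%N -> c <> a -> (c <= U_(x) + a)%MM ->
  (0 < c x)%N /\ mgcd a c != 0%MM.
Proof.
move=> da dc ca /mnm_lepP le; split.
  rewrite lt0n; apply/eqP => cx; case: ca; apply: mdeg_lepm_eq; rewrite ?da ?dc //.
  apply/mnm_lepP => y; have := le y; rewrite mnmDE mnm1E.
  by case: eqP => [<-|_]; rewrite ?cx // add0n.
apply/eqP => g0; have /mnm_lepP/lem_leo/lemc_mdeg : forall y, (c y <= U_(x)%MM y)%N.
  move=> y; have := le y; have := congr1 (fun u : 'X_{1..n} => u y) g0.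
  by rewrite /= mnmDE !mnmE; lia.
by rewrite mdeg1 dc.
Qed.

(** * The submodule spanned by the linear syzygies *)

Section LinearSpan.
Variables (k : fieldType) (n m : nat).
Implicit Types F r s : 'I_m -> {mpoly k[n]}.

Definition linear_span F r : Prop :=
  exists (N : nat) (c : 'I_N -> {mpoly k[n]})
         (s : 'I_N -> 'I_m -> {mpoly k[n]}),
    (forall i, linear_syzygy F (s i)) /\
    (forall j, r j = \sum_(i < N) c i * s i j).

Lemma linear_span_ext F r s : r =1 s -> linear_span F r -> linear_span F s.
Proof. by move=> e [N [c [t [lt rt]]]]; exists N, c, t; split=> // j; rewrite -e. Qed.

Lemma linear_span0 F : linear_span F (fun _ => 0).
Proof.
exists 0%N, (fun _ => 0), (fun _ _ => 0); split=> [[]//|j].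
by rewrite big_ord0.
Qed.

Lemma linear_spanD F r s :
  linear_span F r -> linear_span F s -> linear_span F (fun j => r j + s j).
Proof.
move=> [N [c [t [lt rt]]]] [N' [c' [t' [lt' rt']]]].
exists (N + N')%N.
exists (fun i => match split i with inl a => c a | inr b => c' b end).
exists (fun i => match split i with inl a => t a | inr b => t' b end).
split=> [i|j]; first by case: (split i).
rewrite big_split_ord /= rt rt'; congr (_ + _); apply: eq_bigr => i _.
  by rewrite (unsplitK (inl i : 'I_N + 'I_N')%type).
by rewrite (unsplitK (inr i : 'I_N + 'I_N')%type).
Qed.

Lemma linear_spanM F r (p : {mpoly k[n]}) :
  linear_span F r -> linear_span F (fun j => p * r j).
Proof.
move=> [N [c [t [lt rt]]]]; exists N, (fun i => p * c i), t; split=> // j.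
by rewrite rt mulr_sumr; apply: eq_bigr => i _; rewrite mulrA.
Qed.

Lemma linear_span_gen F r : linear_syzygy F r -> linear_span F r.
Proof.
move=> lr; exists 1%N, (fun _ => 1), (fun _ => r); split=> // j.
by rewrite big_ord1 mul1r.
Qed.

Lemma linear_span_sum F (I : Type) (t : seq I) (P : pred I)
    (r : I -> 'I_m -> {mpoly k[n]}) :
  (forall i, P i -> linear_span F (r i)) ->
  linear_span F (fun j => \sum_(i <- t | P i) r i j).
Proof.
move=> lr; elim: t => [|i t IH].
  by apply: linear_span_ext (linear_span0 F) => j; rewrite big_nil.
case Pi: (P i); last by apply: linear_span_ext IH => j; rewrite big_cons Pi.
by apply: linear_span_ext (linear_spanD (lr i Pi) IH) => j; rewrite big_cons Pi.
Qed.

End LinearSpan.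

(** * Rewriting syzygies of monomials *)

Section Rewriting.
Variables (k : fieldType) (n m : nat) (f : 'I_m -> 'X_{1..n}).

Local Notation F := (fun j => 'X_[f j] : {mpoly k[n]}).

(** The multiple of the i-th basis vector in multidegree a; it is meant for a
    divisible by the i-th monomial. *)
Definition basis_multiple (a : 'X_{1..n}) (i l : 'I_m) : {mpoly k[n]} :=
  if l == i then 'X_[a - f i] else 0.

Lemma sum_basis_multiple (a : 'X_{1..n}) (i : 'I_m) :
  (f i <= a)%MM -> \sum_l basis_multiple a i l * 'X_[f l] = 'X_[a].
Proof.
move=> ia; rewrite (bigD1 i) //= big1 => [|l li].
  by rewrite /basis_multiple eqxx addr0 -mpolyXD submK.
by rewrite /basis_multiple (negbTE li) mul0r.
Qed.

Lemma basis_multipleD (a b : 'X_{1..n}) (i l : 'I_m) :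
  (f i <= a)%MM ->
  basis_multiple (b + a) i l = 'X_[b] * basis_multiple a i l.
Proof.
move=> ia; rewrite /basis_multiple; case: (l == i); last by rewrite mulr0.
by rewrite -addmBA // mpolyXD.
Qed.

Definition span_congruent (r s : 'I_m -> {mpoly k[n]}) : Prop :=
  linear_span F (fun l => r l - s l).

Lemma span_congruent_trans r s t :
  span_congruent r s -> span_congruent s t -> span_congruent r t.
Proof.
move=> rs st; apply: linear_span_ext (linear_spanD rs st) => l.
by rewrite addrA subrK.
Qed.

(** The syzygy of two overlapping quadratic monomials is linear in the degree
    of their least common multiple, which divides a. *)
Lemma basis_multiple_edge (a : 'X_{1..n}) (i j : 'I_m) :
  injective f -> (forall l, mdeg (f l) = 2%N) -> edge_graph f i j ->
  (f i <= a)%MM -> (f j <= a)%MM ->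
  span_congruent (basis_multiple a i) (basis_multiple a j).
Proof.
move=> finj fdeg /andP[ij g0] ia ja; set c := (f j - f i + f i)%MM.
have ic : (f i <= c)%MM by apply: lem_addl.
have jc : (f j <= c)%MM by rewrite /c subm_addC lem_addl.
have ca : (c <= a)%MM.
  apply/mnm_lepP => x; move/mnm_lepP: ia => /(_ x); move/mnm_lepP: ja => /(_ x).
  by rewrite mnmDE mnmBE; lia.
have fij : f i <> f j by move/finj => e; rewrite e eqxx in ij.
have dji : mdeg (f j - f i)%MM = 1%N.
  by apply: mdeg_subm_overlap => //; [exact: nesym | rewrite mgcdC].
have dij : mdeg (f i - f j)%MM = 1%N by apply: mdeg_subm_overlap.
have lin : linear_syzygy F (fun l => basis_multiple c i l - basis_multiple c j l).
  split=> [|l].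
    rewrite /syzygy (eq_bigr _ (fun l _ => mulrBl _ _ _)) sumrB.
    by rewrite !sum_basis_multiple // subrr.
  rewrite rpredB // /basis_multiple; case: eqP => _; rewrite ?rpred0 //.
    by rewrite /c addmK dhomogX /= dji.
  by rewrite /c subm_addC addmK dhomogX /= dij.
apply: linear_span_ext (linear_spanM 'X_[a - c] (linear_span_gen lin)) => l.
by rewrite mulrBr -!basis_multipleD // submK.
Qed.

(** For coprime monomials a common neighbour divides their product, hence a,
    and the difference is a sum of two instances of the previous lemma. *)
Lemma basis_multiple_within_two (a : 'X_{1..n}) (i j : 'I_m) :
  injective f -> (forall l, mdeg (f l) = 2%N) ->
  within_two (edge_graph f) i j ->
  (f i <= a)%MM -> (f j <= a)%MM ->
  span_congruent (basis_multiple a i) (basis_multiple a j).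
Proof.
move=> finj fdeg near ia ja.
case: (eqVneq i j) near => [-> _|ij].
  by apply: linear_span_ext (linear_span0 F) => l; rewrite subrr.
case eij: (edge_graph f i j); first by move=> _; apply: basis_multiple_edge.
rewrite /within_two (negbTE ij) eij /= => /existsP[l /andP[il lj]].
have g0 : mgcd (f i) (f j) = 0%MM.
  by apply/eqP; move: eij; rewrite /edge_graph ij /= => /negbFE.
have la : (f l <= a)%MM.
  apply: (lepm_trans (m2 := (f i + f j)%MM)).
    apply: overlap_both_lepm => //; last by case/andP: lj.
    by rewrite mgcdC; case/andP: il.
  apply/mnm_lepP => x; have := congr1 (fun u : 'X_{1..n} => u x) g0.
  move/mnm_lepP: ia => /(_ x); move/mnm_lepP: ja => /(_ x).
  by rewrite /= mnmDE !mnmE; lia.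
by apply: (@span_congruent_trans _ (basis_multiple a l));
  apply: basis_multiple_edge.
Qed.

(** A chosen lift of the monomial a to the free module; the choice depends on
    a alone. *)
Definition monomial_lift (a : 'X_{1..n}) (l : 'I_m) : {mpoly k[n]} :=
  if [pick j | (f j <= a)%MM] is Some j then basis_multiple a j l else 0.

(** The linear extension of the chosen lifts. The sum runs over all monomials
    of degree less than w, and not over the support of g, so that it is linear
    in g for every w; it lifts an element g of the ideal once w exceeds the
    degree of g. *)
Definition lift (w : nat) (g : {mpoly k[n]}) (l : 'I_m) : {mpoly k[n]} :=
  \sum_(a : 'X_{1..n < w}) g@_a *: monomial_lift a l.

Lemma lift0 w l : lift w 0 l = 0.
Proof. by rewrite /lift big1 // => a _; rewrite mcoeff0 scale0r. Qed.

Lemma lift_sum w (I : Type) (t : seq I) (P : pred I) (g : I -> {mpoly k[n]}) l :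
  lift w (\sum_(i <- t | P i) g i) l = \sum_(i <- t | P i) lift w (g i) l.
Proof.
rewrite /lift exchange_big /=; apply: eq_bigr => a _.
by rewrite raddf_sum scaler_suml.
Qed.

Lemma liftZ w c g l : lift w (c *: g) l = c *: lift w g l.
Proof.
by rewrite /lift scaler_sumr; apply: eq_bigr => a _; rewrite mcoeffZ scalerA.
Qed.

Lemma liftX w a l : (mdeg a < w)%N -> lift w 'X_[a] l = monomial_lift a l.
Proof.
move=> aw; rewrite /lift (bigD1 (BMultinom aw)) //= mcoeffX eqxx scale1r.
rewrite big1 ?addr0 // => b ba; rewrite mcoeffX.
suff /negbTE -> : a != b by rewrite scale0r.
by apply: contra ba => /eqP ab; apply/eqP/val_inj.
Qed.

(** A term x^u e_j lies over x^u f_j, and so does the chosen lift of that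
    monomial: the two are congruent. *)
Lemma lift_congruent (w : nat) (p : {mpoly k[n]}) (j : 'I_m) :
  injective f -> (forall l, mdeg (f l) = 2%N) ->
  (forall i j, within_two (edge_graph f) i j) ->
  (msize p + 2 <= w)%N ->
  span_congruent (fun l => if l == j then p else 0) (lift w (p * 'X_[f j])).
Proof.
move=> finj fdeg near pw.
have term u : u \in msupp p -> linear_span F (fun l =>
    (p@_u)%:MP * (basis_multiple (u + f j) j l - monomial_lift (u + f j) l)).
  move=> up; apply: linear_spanM; rewrite /monomial_lift.
  case: pickP => [i ia|/(_ j)]; last by rewrite lem_addl.
  by apply: basis_multiple_within_two; rewrite ?lem_addl.
have := linear_span_sum (msupp p) term.
rewrite /span_congruent; apply: linear_span_ext => l.
rewrite -big_seq.
have -> : lift w (p * 'X_[f j]) l =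
    \sum_(u <- msupp p) p@_u *: monomial_lift (u + f j) l.
  rewrite {1}(mpolyE p) mulr_suml lift_sum big_seq [RHS]big_seq.
  apply: eq_bigr => u up; rewrite -scalerAl liftZ -mpolyXD liftX //.
  by rewrite mdegD fdeg; have := msize_mdeg_lt up; lia.
have -> : (if l == j then p else 0) =
    \sum_(u <- msupp p) p@_u *: basis_multiple (u + f j) j l.
  rewrite /basis_multiple; case: eqP => _.
    by rewrite {1}(mpolyE p); apply: eq_bigr => u _; rewrite addmK.
  by rewrite big1 // => u _; rewrite scaler0.
rewrite -sumrB; apply: eq_bigr => u _.
by rewrite mul_mpolyC scalerBr.
Qed.

(** Summing the congruences over all coordinates, a syzygy is congruent to the
    lift of zero. *)
Lemma within_two_linearly_presented :
  injective f -> (forall l, mdeg (f l) = 2%N) ->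
  (forall i j, within_two (edge_graph f) i j) -> linearly_presented F.
Proof.
move=> finj fdeg near r syz.
(* Large enough for every monomial of r_j f_j, for all j. *)
pose w := (\max_j (msize (r j) + 2))%N.
have congr j : xpredT j -> span_congruent
    (fun l => if l == j then r j else 0) (lift w (r j * 'X_[f j])).
  move=> _; apply: lift_congruent => //.
  exact: (@leq_bigmax _ (fun j => (msize (r j) + 2)%N)).
have := linear_span_sum (index_enum 'I_m) congr.
apply: linear_span_ext => l; rewrite sumrB -lift_sum.
rewrite [X in lift w X]syz lift0 subr0.
rewrite (bigD1 l) //= eqxx big1 ?addr0 // => j jl.
by rewrite eq_sym (negbTE jl).
Qed.

(** * Common neighbours from linear syzygies *)

(** A linear form in the i-th coordinate forces a common neighbour: if x occurs
    in it and divides f_j, the term x f_i must cancel against a term of another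
    coordinate l, and then f_l divides x f_i without being f_i. *)
Lemma linear_syzygy_common_neighbour (i j : 'I_m) (s : 'I_m -> {mpoly k[n]})
    (x : 'I_n) :
  injective f -> (forall l, mdeg (f l) = 2%N) ->
  mgcd (f i) (f j) = 0%MM -> syzygy F s ->
  (s i)@_(U_(x)) != 0 -> (0 < f j x)%N ->
  exists l, edge_graph f i l && edge_graph f l j.
Proof.
move=> finj fdeg g0 syz sx jx.
have [l li cl] : exists2 l, l != i & (s l * 'X_[f l])@_(U_(x) + f i) != 0.
  apply/exists_inP; apply: contraT => /exists_inPn none; case/eqP: sx.
  have := congr1 (mcoeff (U_(x) + f i)) syz.
  rewrite mcoeff0 raddf_sum /= (bigD1 i) //= [X in _ + X]big1 => [|l /none].
    by rewrite addr0 addmC mcoeffMX.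
  by rewrite negbK => /eqP.
have le : (f l <= U_(x) + f i)%MM.
  move: cl; rewrite -mcoeff_msupp => /msuppM_le/allpairsP[[u v]] /= [_].
  by rewrite msuppX inE => /eqP -> ->; apply: lem_addl.
have fli : f l <> f i by move/finj => e; rewrite e eqxx in li.
have [lx gil] := lepm_addU_overlap (fdeg i) (fdeg l) fli le.
exists l; rewrite /edge_graph eq_sym li gil /=; apply/andP; split.
  by apply: contraNneq gil => ->; rewrite g0.
apply/eqP => /(congr1 (fun u : 'X_{1..n} => u x)).
by rewrite mnmE mnm0E; lia.
Qed.

(** For coprime f_i and f_j, the coefficient of f_j in the i-th coordinate of
    the Koszul syzygy f_j e_i - f_i e_j is 1, so that some linear syzygy of any
    linear presentation has a variable dividing f_j in its i-th coordinate. *)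
Lemma linearly_presented_within_two :
  injective f -> (forall l, mdeg (f l) = 2%N) -> linearly_presented F ->
  forall i j, within_two (edge_graph f) i j.
Proof.
move=> finj fdeg lp i j; rewrite /within_two.
case: (eqVneq i j) => //= ij.
case eij: (edge_graph f i j) => //=.
have g0 : mgcd (f i) (f j) = 0%MM.
  by apply/eqP; move: eij; rewrite /edge_graph ij /= => /negbFE.
pose a := (f j + f i)%MM.
have koszul : syzygy F (fun l => basis_multiple a i l - basis_multiple a j l).
  rewrite /syzygy (eq_bigr _ (fun l _ => mulrBl _ _ _)) sumrB.
  by rewrite !sum_basis_multiple ?subrr ?lem_addl ?lem_addr.
have [N [c [s [lin /(_ i)]]]] := lp _ koszul.
rewrite /basis_multiple eqxx (negbTE ij) subr0 /a addmK.
move=> /(congr1 (mcoeff (f j))); rewrite mcoeffX eqxx raddf_sum /= => one.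
have [t ct] : exists t, (c t * s t i)@_(f j) != 0.
  apply/existsP; apply: contraT; rewrite negb_exists => /forallP none.
  have /eqP := one; rewrite big1 ?oner_eq0 // => t _.
  by have := none t; rewrite negbK => /eqP.
have [syz /(_ i)/dhomogP hom] := lin t.
move: ct; rewrite -mcoeff_msupp => /msuppM_le/allpairsP[[u v]] /= [_ vs fj].
have /eqP/mdeg1P[x /eqP vx] := hom _ vs.
apply/existsP; apply: (linear_syzygy_common_neighbour (s := s t) (x := x)) => //.
  by rewrite -mcoeff_msupp -vx.
by rewrite fj vx mnmDE mnm1E eqxx addn1.
Qed.

End Rewriting.

Theorem lemma5p16 (k : fieldType) (hk : [pchar k] =i pred0) (n m : nat)
    (f : 'I_m -> 'X_{1..n}) (f_distinct : injective f)
    (f_deg2 : forall j, mdeg (f j) = 2%N) (f_cohesive : cohesive f) :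
  linearly_presented (fun j => 'X_[f j] : {mpoly k[n]}) <->
  (diameter (edge_graph f) <= 2)%N.
Proof.
have diamP := diameter_le2P f_deg2 f_cohesive.
split=> [lp|/diamP].
  by apply/diamP; apply: linearly_presented_within_two lp.
exact: within_two_linearly_presented.
Qed.
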